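(* Let $d\ge 2$ and let $\nu$ be a finite measure on $(0,+\infty)$. Consider the continuous greedy paths model driven by $\nu$ with the quantity $S$ defined in the context. 1. If $\int_0^{+\infty}\nu([r,+\infty))^{1/d}\,dr<+\infty$, then $\mathbb{E}S<+\infty$. 2. If $\int_0^{+\infty} r^d\,\nu(dr)=+\infty$, then $S=+\infty$ almost surely.
   Context: Let $\xi$ be a Poisson point process on $\mathbb{R}^d\times(0,+\infty)$ with intensity the product of Lebesgue measure on $\mathbb{R}^d$ and $\nu$, and let $\Xi$ be its projection on $\mathbb{R}^d$. For $x\in\Xi$, $r(x)$ denotes the (a.s. unique) positive real with $(x,r(x))\in\xi$; for $x\notin\Xi$, $r(x)=0$. A path is a finite sequence $\pi=(x_0,\dots,x_n)$ of distinct points of $\mathbb{R}^d$; its length $|\pi|=\sum_{i=0}^{n-1}\|x_{i+1}-x_i\|$ (Euclidean norm), and its weight $A(\pi)=\sum_{i=0}^n r(x_i)$. Define $S=S(\xi)=\sup\{A(\pi)/|\pi|\}$, the supremum over all paths with $x_0=0$ and $|\pi|>0$. (One works on the almost sure event $0\notin\Xi$.) *)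

(* Defs.v *)
From mathcomp Require Import all_boot all_algebra.
From mathcomp Require Import all_classical all_reals all_analysis.
From mathcomp Require Import measurable_realfun.
Set Implicit Arguments. Unset Strict Implicit. Unset Printing Implicit Defensive.
Import GRing.Theory Num.Theory.

Local Open Scope classical_set_scope.
Local Open Scope ring_scope.

Section greedy_paths.
Context {R : realType} {d : nat}.

Definition eucl (x : 'rV[R]_d) : R := Num.sqrt (\sum_(i < d) x ord0 i ^+ 2).

(* r(x) for a configuration xi of marked points: the mark r with (x,r) in xi,
   and 0 if x is not in the projection of xi.  (We take the supremum of the
   marks above x, together with 0; on the almost sure event where marks are
   unique and positive this is exactly r(x).) *)
Definition rmark (xi : set ('rV[R]_d * R)) (x : 'rV[R]_d) : \bar R :=
  ereal_sup ([set 0%E] `|` [set (p.2)%:E | p in [set p | xi p /\ p.1 = x]]).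

Definition path_length (s : seq 'rV[R]_d) : R :=
  \sum_(i < (size s).-1) eucl (nth 0 s i.+1 - nth 0 s i).

Definition path_weight (xi : set ('rV[R]_d * R)) (s : seq 'rV[R]_d) : \bar R :=
  (\sum_(x <- s) rmark xi x)%E.

Definition admissible_path (s : seq 'rV[R]_d) : Prop :=
  [/\ uniq s, s = 0 :: behead s & 0 < path_length s].

Definition greedy_S (xi : set ('rV[R]_d * R)) : \bar R :=
  ereal_sup [set (path_weight xi s * ((path_length s)^-1)%:E)%E
            | s in admissible_path].

Definition cell (a b : 'I_d -> R) (s t : R) : set ('rV[R]_d * R) :=
  [set p : 'rV[R]_d * R | (forall j, a j <= p.1 ord0 j < b j) /\ s <= p.2 < t].

Definition poisson_p (m : R) (k : nat) : R :=
  expR (- m) * m ^+ k / k`!%:R.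

(* xi is a Poisson point process on R^d x (0,+oo) with intensity
   Leb_d (x) nu: the points lie in R^d x (0,+oo), and for any finite family of
   pairwise disjoint cells C_i = [a_i,b_i) x [s_i,t_i) (0 < s_i), the counts
   #(xi cap C_i) are independent Poisson variables with means
   Leb_d([a_i,b_i)) * nu([s_i,t_i)), i.e. for all k_i the event
   {forall i, #(xi cap C_i) = k_i} is measurable and has probability
   prod_i Poisson(m_i)(k_i). *)
Definition is_poisson_pp (dd : measure_display) (Om : measurableType dd)
  (P : probability Om R) (nu : {finite_measure set R -> \bar R})
  (xi : Om -> set ('rV[R]_d * R)) : Prop :=
  (forall w, xi w `<=` [set p | 0 < p.2]) /\
  forall (n : nat) (a b : 'I_n -> 'I_d -> R) (s t : 'I_n -> R) (k : 'I_n -> nat),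
    (forall i, 0 < s i) -> (forall i, s i <= t i) ->
    (forall i j, a i j <= b i j) ->
    (forall i i', i != i' -> cell (a i) (b i) (s i) (t i) `&`
                             cell (a i') (b i') (s i') (t i') = set0) ->
    let E := [set w | forall i, ((xi w `&` cell (a i) (b i) (s i) (t i)) #= `I_(k i))%card] in
    measurable E /\
    P E = (\prod_(i < n)
             poisson_p ((\prod_(j < d) (b i j - a i j)) * fine (nu `[s i, t i[%classic)) (k i))%:E.

End greedy_paths.

(* Main.v *)
Require Import Defs.
From mathcomp Require Import all_boot all_order all_algebra.
From mathcomp Require Import all_classical all_reals all_analysis.
From mathcomp Require Import measurable_realfun.
From mathcomp Require Import ring lra zify.
Set Implicit Arguments. Unset Strict Implicit. Unset Printing Implicit Defensive.
Import Order.TTheory GRing.Theory Num.Theory.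
Local Open Scope classical_set_scope.
Local Open Scope ring_scope.

(** Split the marks into dyadic bands [[s, t[].  If a path of length at most
    [n h] visits [n] points of one band, the cubes of side [h] containing these
    points, taken in order, form a lattice walk of total variation at most
    [2 d n].  There are at most [12 ^ (d n)] such walks, and by independence
    each of them meets enough points with probability at most
    [(h ^ d nu[s, t[) ^ n].  Summing over [n], the maximal density of band
    points along a path exceeds [M] with probability [O(nu[s, t[ / M ^ d)];
    since [d >= 2] this is integrable in [M] and the expected density is
    [O(nu[s, t[ ^ (1 / d))].  The dyadic sum of [t] times this bound is
    controlled by the integral.

    For the divergence, the numbers of points [(x, r)] with [r >= M |x|] in
    the successive bands are independent with infinite total mean, so that
    almost surely there is one; the path [(0, x)] then has ratio at least
    [M]. *)

(** * Counts of a Poisson process in disjoint cells *)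

Section independent_tails.
Context {R : realType} {dd : measure_display} {Om : measurableType dd}.
Variables (P : probability Om R) (n : nat).
Variables (F : 'I_n -> nat -> set Om) (q : 'I_n -> nat -> R).
Hypothesis mF : forall i k, measurable (F i k).
Hypothesis trivF : forall i, trivIset setT (F i).
Hypothesis PF : forall (D : {set 'I_n}) (k : 'I_n -> nat),
  P [set w | forall i, i \in D -> F i (k i) w] = (\prod_(i in D) q i (k i))%:E.

Let event (D D' : {set 'I_n}) (k m : 'I_n -> nat) : set Om :=
  [set w | (forall i, i \in D -> F i (k i) w) /\
           (forall i, i \in D' -> forall j, (j < m i)%N -> ~ F i j w)].

Let measurable_event D D' k m : measurable (event D D' k m).
Proof.
rewrite (_ : event D D' k m = (\bigcap_(i in [set` D]) F i (k i)) `&`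
   \bigcap_(i in [set` D']) \bigcap_(j in `I_(m i)) ~` F i j)//.
apply: measurableI; apply: fin_bigcap_measurable => // i _.
by apply: fin_bigcap_measurable => // j _; exact: measurableC.
Qed.

Let prob_event (D' D : {set 'I_n}) (k m : 'I_n -> nat) :
  (forall i, i \in D -> i \notin D') ->
  P (event D D' k m) = ((\prod_(i in D) q i (k i)) *
    \prod_(i in D') (1 - \sum_(j < m i) q i j))%:E.
Proof.
move: {2}#|D'| (leqnn #|D'|) => N; elim: N D' D k => [|N IH] D' D k.
  rewrite leqn0 cards_eq0 => /eqP -> _.
  rewrite big_set0 mulr1 -PF; congr (P _).
  apply/seteqP; split => [w []//|w H]; split => // i; by rewrite inE.
have [->|/set0Pn[i iD']] := eqVneq D' finset.set0.
  by move=> _ dis; apply: IH => //; rewrite cards0.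
rewrite (cardsD1 i) iD' add1n ltnS => cD' dis.
pose D1 := D' :\ i.
have dis1 i' : i' \in D -> i' \notin D1.
  by rewrite in_setD1 negb_and => /dis ->; rewrite orbT.
have iD : i \notin D by apply: contraL iD' => /dis.
pose ki j i' := if i' == i then j else k i'.
have step j : event D D1 k m `&` F i j = event (i |: D) D1 (ki j) m.
  apply/seteqP; split => [w [[H1 H2] Fj]|w [H1 H2]].
    split=> // i'; rewrite in_setU1 /ki; case: eqP => [->//|_] /=; exact: H1.
  split; first split=> //.
    move=> i' i'D; have := H1 i'; rewrite in_setU1 /ki i'D orbT => /(_ isT).
    by rewrite ifN//; apply: contraNneq iD => <-.
  by have := H1 i; rewrite in_setU1 /ki eqxx => /(_ isT).
have -> : event D D' k m = event D D1 k m `\` \big[setU/set0]_(j < m i) F i j.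
  rewrite -bigcup_mkord.
  apply/seteqP; split => [w [H1 H2]|w [[H1 H2] H3]].
    split; last by move=> [j /= jm]; exact: (H2 _ iD').
    by split=> // i'; rewrite in_setD1 => /andP[_]; exact: H2.
  split=> // i' i'D' j jm Fj.
  have [ei|ne] := eqVneq i' i; first by apply: H3; exists j => /=; rewrite -?ei.
  by apply: (H2 i' _ j jm Fj); rewrite in_setD1 ne.
rewrite measureD//; last 2 first.
- by apply: bigsetU_measurable => j _; exact: mF.
- by rewrite (le_lt_trans (probability_le1 _ _)) ?ltry.
rewrite big_distrr/= (eq_bigr (fun j : 'I__ => event (i |: D) D1 (ki j) m)); last first.
  by move=> j _; exact: step.
rewrite measure_bigsetU_ord//; last first.
  apply/trivIsetP => a b _ _ ab; rewrite -!step setIACA setIid.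
  have /trivIsetP/(_ (val a) (val b) Logic.I Logic.I ab) -> := @trivF i.
  by rewrite setI0.
rewrite IH//.
rewrite (eq_bigr (fun j : 'I__ => ((\prod_(i in D) q i (k i)) * q i j *
    \prod_(i in D1) (1 - \sum_(j < m i) q i j))%:E)); last first.
  move=> j _ /=; rewrite IH//.
    congr (_ * _)%:E; rewrite (big_setD1 i) ?setU11//= setU1K// mulrC /ki eqxx.
    congr (_ * _); apply: eq_bigr => i' i'D.
    by rewrite ifN//; apply: contraNneq iD => <-.
  by move=> i'; rewrite in_setU1 => /orP[/eqP->|/dis1//]; rewrite in_setD1 eqxx.
rewrite sumEFin -EFinB; congr _%:E.
by rewrite (big_setD1 i iD')/= -/D1 -mulr_suml -mulr_sumr; ring.
Qed.

Lemma prob_forall_tail (m : 'I_n -> nat) :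
  let E := [set w | forall i j, (j < m i)%N -> ~ F i j w] in
  measurable E /\ P E = (\prod_(i < n) (1 - \sum_(j < m i) q i j))%:E.
Proof.
set E := [set w | _].
have -> : E = event finset.set0 finset.setT m m.
  apply/seteqP; split => [w H|w [_ H] i]; last by apply: H; rewrite inE.
  by split => i; [rewrite inE | move=> _; exact: H].
split=> //; rewrite prob_event; last by move=> i; rewrite inE.
rewrite big_set0 mul1r.
by congr _%:E; apply: eq_bigl => i; rewrite inE.
Qed.

End independent_tails.

Lemma poisson_tail (R : realType) (p : R) (m : nat) : 0 <= p ->
  1 - \sum_(k < m) poisson_p p k <= p ^+ m.
Proof.
move=> p0.
suff : expR p <= \sum_(k < m) p ^+ k / k`!%:R + p ^+ m * expR p.
  move=> H.
  have -> : \sum_(k < m) poisson_p p k = expR (- p) * \sum_(k < m) p ^+ k / k`!%:R.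
    by rewrite mulr_sumr; apply: eq_bigr => i _; rewrite /poisson_p mulrA.
  have := ler_wpM2l (expR_ge0 (- p)) H.
  rewrite expRN mulrDr mulVf ?gt_eqF ?expR_gt0// mulrCA mulVf ?gt_eqF ?expR_gt0//.
  by rewrite mulr1 -lerBlDl.
have pos n : 0 <= exp_coeff p n by rewrite exp_coeff_ge0.
rewrite {1}/expR; apply: limr_le; first exact: is_cvg_series_exp_coeff.
near=> n.
rewrite /series/=.
have mn : (m <= n)%N by near: n; exact: nbhs_infty_ge.
rewrite (big_cat_nat (leq0n m) mn)/= big_mkord; apply: lerD.
  by [].
rewrite -{1}(add0n m) big_addn.
apply: (@le_trans _ _ (p ^+ m * \sum_(0 <= i < n - m) exp_coeff p i)).
  rewrite mulr_sumr; apply: ler_sum => i _.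
  rewrite /exp_coeff/= exprD mulrA [p ^+ m * _]mulrC ler_wpM2l//.
    by rewrite mulr_ge0 ?exprn_ge0.
  by rewrite lef_pV2 ?posrE ?ltr0n ?fact_gt0// ler_nat leq_fact// leq_addr.
rewrite ler_wpM2l ?exprn_ge0//.
by rewrite -/(series (exp_coeff p) (n - m)%N) nondecreasing_cvgn_le//; [
   apply: nondecreasing_series => i _ _ | exact: is_cvg_series_exp_coeff].
Unshelve. all: by end_near. Qed.

Lemma uniq_fst_card_lt (T U : eqType) (A : set (T * U)) (k : nat) (l : seq T) :
  uniq l -> (forall x, x \in l -> exists y, A (x, y)) -> (k < size l)%N ->
  ~ (A #= `I_k)%card.
Proof.
move=> ul lA kl /card_set_bijP[f [fA finj _]].
pose g x := if pselect (exists y, A (x, y)) is left ex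
  then f (x, projT1 (cid ex)) else 0%N.
have gE x : x \in l -> exists2 y, A (x, y) & g x = f (x, y).
  move=> /lA ex; rewrite /g; case: pselect => // ex'.
  by exists (projT1 (cid ex')) => //; case: cid.
have : (size (map g l) <= size (iota 0 k))%N.
  apply: uniq_leq_size => [|_ /mapP[x /gE[y Axy gx] ->]].
    rewrite map_inj_in_uniq// => x x' /gE[y Axy ->] /gE[y' Axy' ->].
    by move/finj; rewrite !inE => /(_ Axy Axy') [].
  by rewrite mem_iota gx; exact: fA.
by rewrite size_map size_iota leqNgt kl.
Qed.

Section poisson_counts.
Context {R : realType} {d : nat} {dd : measure_display} {Om : measurableType dd}.
Variables (P : probability Om R) (nu : {finite_measure set R -> \bar R}).
Variable xi : Om -> set ('rV[R]_d * R).
Hypothesis xiP : is_poisson_pp P nu xi.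
Variables (n : nat) (a b : 'I_n -> 'I_d -> R) (s t : 'I_n -> R).
Hypotheses (s_gt0 : forall i, 0 < s i) (s_le_t : forall i, s i <= t i).
Hypothesis a_le_b : forall i j, a i j <= b i j.

Let C i := cell (a i) (b i) (s i) (t i).
Let mean i := (\prod_(j < d) (b i j - a i j)) * fine (nu `[s i, t i[%classic).

Hypothesis disjC : forall i i', i != i' -> C i `&` C i' = set0.

(* A cell is dropped from the family by emptying its range of marks. *)
Let counts_in (D : {set 'I_n}) (k : 'I_n -> nat) :
  let E := [set w | forall i, i \in D -> ((xi w `&` C i) #= `I_(k i))%card] in
  measurable E /\ P E = (\prod_(i in D) poisson_p (mean i) (k i))%:E.
Proof.
pose t' i := if i \in D then t i else s i.
pose k' i := if i \in D then k i else 0%N.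
have subC i : cell (a i) (b i) (s i) (t' i) `<=` C i.
  rewrite /t' /C; case: ifP => _ p []// _ /andP[sp /(le_lt_trans sp)].
  by rewrite ltxx.
have [_ /(_ n a b s t' k' s_gt0)] := xiP.
case=> //.
- by move=> i; rewrite /t'; case: ifP.
- move=> i i' ii'; rewrite -subset0 -(disjC ii').
  by apply: setISS; exact: subC.
set E' := [set w | _] => mE' PE'.
set E := [set w | _].
have -> : E = E'.
  apply/seteqP; split=> w H i.
    rewrite /t' /k'; case: ifPn => iD; first exact: H.
    rewrite (_ : _ `&` _ = set0) ?card_eqxx ?II0//.
    by apply/seteqP; split=> // p [_ [_ /andP[sp /(le_lt_trans sp)]]]; rewrite ltxx.
  by move=> iD; have := H i; rewrite /t' /k' iD.
split=> //; rewrite PE'; congr _%:E.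
rewrite [RHS]big_mkcond/=; apply: eq_bigr => i _; rewrite /t' /k'.
case: ifP => // _.
by rewrite set_itvco0 measure0 mulr0 /poisson_p oppr0 expR0 expr0 fact0 mul1r divr1.
Qed.

Lemma prob_counts_ge (m : 'I_n -> nat) :
  let E := [set w | forall i j, (j < m i)%N -> ~ ((xi w `&` C i) #= `I_j)%card] in
  measurable E /\ (P E <= (\prod_(i < n) mean i ^+ m i)%:E)%E.
Proof.
pose F i k := [set w | ((xi w `&` C i) #= `I_k)%card].
have mF i k : measurable (F i k).
  have [+ _] := counts_in [set i]%SET (fun=> k).
  rewrite (_ : [set w | _] = F i k)//.
  apply/seteqP; split=> [w /(_ i)|w Fw i']; first by rewrite inE eqxx; exact.
  by rewrite inE => /eqP ->.
have trivF i : trivIset setT (F i).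
  apply/trivIsetP => j k _ _; apply: contraNeq => /set0P[w [Fj Fk]].
  by apply/eqP/card_eq_II; apply: card_eq_trans Fk; rewrite card_eq_sym.
have PF D k := (counts_in D k).2.
pose q i := poisson_p (mean i).
have [mE PE] := @prob_forall_tail _ _ _ _ _ F q mF trivF PF m.
split=> //; rewrite PE lee_fin; apply: ler_prod => i _.
have mean0 : 0 <= mean i.
  rewrite mulr_ge0 ?fine_ge0//.
  by apply: prodr_ge0 => j _; rewrite subr_ge0.
apply/andP; split; last exact: poisson_tail.
pose m' i' := if i' == i then m i else 0%N.
have [_ PEi] := @prob_forall_tail _ _ _ _ _ F q mF trivF PF m'.
have : (0 <= (\prod_(i0 < n) (1 - \sum_(j < m' i0) q i0 j))%:E :> \bar R)%E.
  by rewrite -PEi.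
have mi : m' i = m i by rewrite /m' eqxx.
rewrite lee_fin (bigD1 i)//= mi [X in _ * X]big1 ?mulr1 => [//|i' /negbTE i'i].
have -> : m' i' = 0%N by rewrite /m' i'i.
by rewrite big_ord0 subr0.
Qed.

Lemma prob_counts_eq0 :
  let E := [set w | forall i, xi w `&` C i = set0] in
  measurable E /\ P E = (expR (- \sum_(i < n) mean i))%:E.
Proof.
have [mE PE] := counts_in finset.setT (fun=> 0%N).
set E := [set w | _].
rewrite (_ : [set w | _] = E) in mE PE; last first.
  apply/seteqP; split=> w H i.
    by have := H i; rewrite inE II0 card_eq0 => /(_ isT) /eqP.
  by rewrite H II0.
split=> //; rewrite PE -sumrN expR_sum; congr _%:E.
rewrite big_mkcond/=; apply: eq_bigr => i _.
by rewrite inE /poisson_p expr0 fact0 mulr1 divr1.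
Qed.

End poisson_counts.

(** * Lattice walks *)

Lemma sum_pow2_dist (Q : nat) :
  (\sum_(k < Q.*2.+1) 2 ^ (Q - `|k%:Z - Q%:Z|) <= 3 * 2 ^ Q)%N.
Proof.
have geo m : (\sum_(i < m) 2 ^ i = (2 ^ m).-1)%N by rewrite predn_exp mul1n.
rewrite -(big_mkord xpredT (fun k => 2 ^ (Q - `|k%:Z - Q%:Z|))%N).
rewrite (@big_cat_nat _ _ _ Q)//=; last by rewrite -addnn leqW ?leq_addr.
rewrite (_ : 3 * 2 ^ Q = 2 ^ Q + 2 ^ Q.+1)%N; last by rewrite expnS; lia.
apply: leq_add.
  rewrite (eq_big_nat _ _ (F2 := fun k => 2 ^ k)%N); last first.
    by move=> i /andP[_ iQ]; congr (2 ^ _)%N; lia.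
  by rewrite big_mkord geo leq_pred.
rewrite -{1}[Q]add0n big_addn.
rewrite (eq_big_nat _ _ (F2 := fun k => 2 ^ (Q - k))%N); last first.
  by move=> i _; congr (2 ^ _)%N; lia.
rewrite (_ : Q.*2.+1 - Q = Q.+1)%N; last lia.
rewrite big_rev_mkord subn0 (eq_bigr (fun k : 'I__ => 2 ^ k)%N) ?geo ?leq_pred//.
by move=> i _; congr (2 ^ _)%N; have := ltn_ord i; lia.
Qed.

(* Increments in [-Q, Q] are shifted by Q, to range over a finite type. *)
Definition short_increments (I : finType) (Q : nat) :
    pred {ffun I -> 'I_Q.*2.+1} :=
  fun w => (\sum_i `|(w i)%:Z - Q%:Z| <= Q)%N.

(* Weight each increment k by 2 ^- `|k|: a short family has weight at least
   2 ^- Q, while the total weight of all families is at most 3 ^ #|I|. *)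
Lemma card_short_increments (I : finType) (Q : nat) :
  (#|@short_increments I Q| <= 2 ^ Q * 3 ^ #|I|)%N.
Proof.
rewrite -(@leq_pmul2r (2 ^ (Q * #|I|))) ?expn_gt0// -sum1_card big_distrl/=.
have : (\sum_(f : {ffun I -> 'I_Q.*2.+1}) \prod_i 2 ^ (Q - `|(f i)%:Z - Q%:Z|)
    <= (3 * 2 ^ Q) ^ #|I|)%N.
  rewrite -(bigA_distr_bigA (fun _ k => 2 ^ (Q - `|(k : 'I_Q.*2.+1)%:Z - Q%:Z|))%N).
  by rewrite prod_nat_const; case: #|I| => [|m] //; rewrite leq_exp2r ?sum_pow2_dist.
rewrite expnMn -expnM => H.
rewrite -mulnA; apply: leq_trans (leq_mul (leqnn (2 ^ Q)%N) H).
rewrite big_distrr/= [leqRHS](bigID (@short_increments I Q))/=.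
apply: leq_trans (leq_addr _ _); apply: leq_sum => w short_w.
rewrite mul1n -expn_sum -expnD leq_exp2l//.
have -> : (Q * #|I| = \sum_(i : I) Q)%N by rewrite sum_nat_const mulnC.
have : (\sum_(i : I) Q <= \sum_i (Q - `|(w i)%:Z - Q%:Z|) +
                          \sum_i `|(w i)%:Z - Q%:Z|)%N.
  by rewrite -big_split; apply: leq_sum => i _ /=; rewrite addnC -leq_subLR.
move=> /leq_trans; apply.
by rewrite addnC leq_add2r.
Qed.

Section lattice.
Context {R : realType} {d : nat}.

Definition cube (h s t : R) (c : {ffun 'I_d -> int}) : set ('rV[R]_d * R) :=
  cell (fun j => (c j)%:~R * h) (fun j => (c j + 1)%:~R * h) s t.

Definition cube_index (h : R) (x : 'rV[R]_d) : {ffun 'I_d -> int} :=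
  [ffun j => Num.floor (x ord0 j / h)].

Lemma mem_cube (h s t : R) c p : 0 < h ->
  cube h s t c p <-> cube_index h p.1 = c /\ s <= p.2 < t.
Proof.
move=> h0; split=> [[H st]|[<- st]]; split=> //.
  apply/ffunP => j; rewrite ffunE; apply: floor_def.
  by rewrite ler_pdivlMr// ltr_pdivrMr.
move=> j; rewrite ffunE -ler_pdivlMr// -ltr_pdivrMr// floor_le_tmp floorD1_gt//.
Qed.

Context {dd : measure_display} {Om : measurableType dd}.
Variables (P : probability Om R) (nu : {finite_measure set R -> \bar R}).
Variable xi : Om -> set ('rV[R]_d * R).
Hypothesis xiP : is_poisson_pp P nu xi.
Variables (h s t : R).
Hypotheses (h_gt0 : 0 < h) (s_gt0 : 0 < s) (s_le_t : s <= t).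

Definition occupied (zs : seq {ffun 'I_d -> int}) : set Om :=
  [set w | forall c k, (k < count_mem c zs)%N ->
           ~ ((xi w `&` cube h s t c) #= `I_k)%card].

Lemma prob_occupied zs : measurable (occupied zs) /\
  (P (occupied zs) <= ((h ^+ d * fine (nu `[s, t[%classic)) ^+ size zs)%:E)%E.
Proof.
pose u := undup zs.
pose c (i : 'I_(size u)) := tnth (in_tuple u) i.
have [] := @prob_counts_ge R d dd Om P nu xi xiP (size u)
  (fun i j => (c i j)%:~R * h) (fun i j => (c i j + 1)%:~R * h)
  (fun=> s) (fun=> t) (fun=> s_gt0) (fun=> s_le_t) _ _
  (fun i => count_mem (c i) zs).
- by move=> i j; rewrite ler_wpM2r ?(ltW h_gt0)// ler_int lerDl.
- move=> i i'; apply: contraNeq => /set0P[p []].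
  move=> /(mem_cube _ _ _ _ h_gt0)[e _] /(mem_cube _ _ _ _ h_gt0)[e' _].
  apply/eqP; have /tuple_uniqP/(_ i i') : uniq (in_tuple u) by exact: undup_uniq.
  by apply; rewrite -/(c i) -/(c i') -e -e'.
rewrite (_ : [set w | _] = occupied zs); last first.
  apply/seteqP; split=> w H.
    move=> z k kz; have zu : z \in u.
      by rewrite mem_undup -has_pred1 has_count (leq_trans _ kz).
    have /tnthP[i zi] : z \in in_tuple u by [].
    by rewrite zi; apply: H; rewrite /c -zi.
  by move=> i j jm; exact: H.
move=> mE PE; split=> //; apply: (le_trans PE); rewrite lee_fin.
rewrite (eq_bigr (fun i =>
  (h ^+ d * fine (nu `[s, t[%classic)) ^+ count_mem (c i) zs)); last first.
  move=> i _; congr ((_ * _) ^+ _).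
  rewrite (eq_bigr (fun=> h)) ?prodr_const ?card_ord// => j _.
  by rewrite -mulrBl intrD addrAC subrr add0r mul1r.
set p := _ * fine _.
rewrite -(big_tnth _ _ u xpredT (fun z => p ^+ count_mem z zs)).
rewrite (eq_bigr (fun z => iterop (count_mem z zs) *%R p 1)); last first.
  by [].
by rewrite big_undup_iterop_count big_const_seq count_predT iter_mulr_1.
Qed.

End lattice.

Section walks.
Context {R : realType} {d : nat}.

Definition walk (n Q : nat) (w : {ffun 'I_n * 'I_d -> 'I_Q.*2.+1}) :
    seq {ffun 'I_d -> int} :=
  [seq [ffun j => \sum_(i' < n | (i' <= i)%N) ((w (i', j))%:Z - Q%:Z)]
  | i : 'I_n <- enum 'I_n].

Lemma size_walk n Q (w : {ffun 'I_n * 'I_d -> 'I_Q.*2.+1}) : size (walk w) = n.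
Proof. by rewrite size_map size_enum_ord. Qed.

Lemma floor_dist (x y : R) : (`|Num.floor x - Num.floor y|)%:~R <= `|x - y| + 1 :> R.
Proof.
rewrite intr_norm intrB; have := floor_le_tmp x; have := floorD1_gt x.
have := floor_le_tmp y; have := floorD1_gt y; rewrite !intrD.
move=> h1 h2 h3 h4.
have : x - y <= `|x - y| by exact: ler_norm.
have : - (x - y) <= `|x - y| by rewrite -normrN ler_norm.
by rewrite ler_norml; lra.
Qed.

Lemma walk_of_points (h : R) (ys : seq 'rV[R]_d) : 0 < h ->
  \sum_(i < size ys) \sum_(j < d)
     `|nth 0 ys i ord0 j - nth 0 (0 :: ys) i ord0 j| <= (d * size ys)%:R * h ->
  exists2 w : {ffun 'I_(size ys) * 'I_d -> 'I_(2 * d * size ys).*2.+1},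
    short_increments w & walk w = map (cube_index h) ys.
Proof.
move=> h0 Hys; set n := size ys; set Q := (2 * d * n)%N.
pose z (i : nat) j := Num.floor (nth 0 (0 :: ys) i ord0 j / h).
pose st (i : 'I_n) j := z i.+1 j - z i j.
have sumst : (\sum_(p : 'I_n * 'I_d) `|st p.1 p.2| <= Q)%N.
  rewrite -(ler_nat R) natr_sum.
  apply: (@le_trans _ _ (\sum_(p : 'I_n * 'I_d)
    (`|nth 0 ys p.1 ord0 p.2 - nth 0 (0 :: ys) p.1 ord0 p.2| / h + 1))).
    apply: ler_sum => -[i j] _ /=.
    rewrite natr_absz; apply: le_trans (floor_dist _ _) _.
    by rewrite lerD2r -mulrBl normrM [`|h^-1|]gtr0_norm ?invr_gt0.
  rewrite big_split/= sumr_const card_prod !card_ord -mulr_suml.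
  rewrite -(pair_bigA _ (fun (i : 'I_n) (j : 'I_d) =>
    `|nth 0 ys i ord0 j - nth 0 (0 :: ys) i ord0 j|))/=.
  rewrite /Q -mulnA mul2n -addnn natrD; apply: lerD; last by rewrite mulnC.
  by rewrite ler_pdivrMr.
have stQ i j : (`|st i j| <= Q)%N.
  by apply: leq_trans sumst; rewrite (bigD1 (i, j))//= leq_addr.
pose w : {ffun 'I_n * 'I_d -> 'I_Q.*2.+1} :=
  [ffun p => inord `|st p.1 p.2 + Q%:Z|].
have wE i j : (w (i, j))%:Z - Q%:Z = st i j.
  rewrite ffunE/= inordK; have := stQ i j; move: (st i j) => k; lia.
exists w.
  rewrite /short_increments.
  rewrite (eq_bigr (fun p => `|st p.1 p.2|%N)) => [//|[i j] _].
  by rewrite wE.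
apply: (@eq_from_nth _ [ffun=> 0]); first by rewrite size_walk size_map.
move=> i; rewrite size_walk => ilt.
rewrite (nth_map (Ordinal ilt)) ?size_enum_ord// (nth_map 0)//.
apply/ffunP => j; rewrite !ffunE nth_enum_ord//.
under eq_bigr => i' _ do rewrite wE.
rewrite -(big_ord_widen n (fun k => z k.+1 j - z k j) ilt).
rewrite -(big_mkord xpredT (fun k => z k.+1 j - z k j)) telescope_sumr//.
by rewrite /z /= mxE mul0r floor0 subr0.
Qed.

Context {dd : measure_display} {Om : measurableType dd}.
Variables (P : probability Om R) (nu : {finite_measure set R -> \bar R}).
Variable xi : Om -> set ('rV[R]_d * R).
Hypothesis xiP : is_poisson_pp P nu xi.
Variables (h s t : R).
Hypotheses (h_gt0 : 0 < h) (s_gt0 : 0 < s) (s_le_t : s <= t).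

Definition crowded (n : nat) : set Om :=
  \bigcup_(w in [set` @short_increments ('I_n * 'I_d)%type (2 * d * n)])
    occupied xi h s t (walk w).

Lemma prob_crowded n : measurable (crowded n) /\
  (P (crowded n) <=
    ((12 ^+ d * (h ^+ d * fine (nu `[s, t[%classic))) ^+ n)%:E)%E.
Proof.
set p := h ^+ d * _.
have p0 : 0 <= p by rewrite mulr_ge0 ?fine_ge0 ?exprn_ge0 ?(ltW h_gt0).
have occ (w : {ffun 'I_n * 'I_d -> 'I_(2 * d * n).*2.+1}) :=
  prob_occupied xiP h_gt0 s_gt0 s_le_t (walk w).
suff [mE PE] : measurable (crowded n) /\ (P (crowded n) <=
    \sum_(w | @short_increments ('I_n * 'I_d)%type (2 * d * n) w) (p ^+ n)%:E)%E.
  split=> //; apply: (le_trans PE); rewrite sumEFin lee_fin sumr_const.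
  rewrite -[leLHS]mulr_natl [leRHS]exprMn ler_wpM2r ?exprn_ge0//.
  rewrite -exprM -[12]/(12%:R) -natrX ler_nat.
  apply: (leq_trans (card_short_increments _ _)).
  by rewrite card_prod !card_ord [(n * d)%N]mulnC -mulnA expnM -expnMn.
rewrite /crowded bigcup_pred.
apply: (big_ind2 (fun (A : set Om) x => measurable A /\ (P A <= x)%E)).
- by rewrite measure0.
- move=> A x B y [mA Ax] [mB By]; split; first exact: measurableU.
  by apply: le_trans (measureU2 _ mA mB) _; exact: leeD.
- by move=> w _; have := occ w; rewrite size_walk.
Qed.

Lemma crowded_points w (ys : seq 'rV[R]_d) : uniq ys ->
  (forall x, x \in ys -> exists2 r, xi w (x, r) & s <= r < t) ->
  \sum_(i < size ys) \sum_(j < d)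
     `|nth 0 ys i ord0 j - nth 0 (0 :: ys) i ord0 j| <= (d * size ys)%:R * h ->
  crowded (size ys) w.
Proof.
move=> uys ysP /(walk_of_points h_gt0)[u short_u walk_u].
exists u => //; rewrite walk_u => c k.
rewrite count_map -size_filter; apply: uniq_fst_card_lt.
  exact: filter_uniq.
move=> x; rewrite mem_filter => /andP[/= /eqP xc /ysP[r xr str]].
by exists r; split=> //; apply/mem_cube.
Qed.

End walks.

(** * Density of the points of one band along a path *)

Section coordinate_variation.
Context {R : realType} {d : nat}.

Definition variation (f : 'rV[R]_d -> R) (x : 'rV[R]_d) (l : seq 'rV[R]_d) : R :=
  \sum_(i < size l) `|f (nth 0 l i) - f (nth 0 (x :: l) i)|.

Lemma variation_cons f x y l :
  variation f x (y :: l) = `|f y - f x| + variation f y l.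
Proof. by rewrite /variation big_ord_recl. Qed.

Lemma variation_shift f x y l :
  variation f x l <= `|f y - f x| + variation f y l.
Proof.
case: l => [|z l]; first by rewrite /variation !big_ord0 addr0.
rewrite !variation_cons addrA lerD2r.
by rewrite (_ : f z - f x = (f y - f x) + (f z - f y)) ?ler_normD//; ring.
Qed.

Lemma variation_filter f a x l : variation f x (seq.filter a l) <= variation f x l.
Proof.
elim: l x => [//|y l IH] x /=; case: ifP => _; rewrite !variation_cons.
  by rewrite lerD2l.
by apply: le_trans (variation_shift _ _ y _) _; rewrite lerD2l.
Qed.

Lemma ler_coord_eucl (x : 'rV[R]_d) j : `|x ord0 j| <= eucl x.
Proof.
rewrite /eucl -sqrtr_sqr ler_wsqrtr// (bigD1 j)//= lerDl.
by apply: sumr_ge0 => i _; exact: sqr_ge0.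
Qed.

Lemma variation_le_path_length (l : seq 'rV[R]_d) j :
  variation (fun x => x ord0 j) 0 l <= path_length (0 :: l).
Proof.
rewrite /variation /path_length /=; apply: ler_sum => i _.
by apply: le_trans (ler_coord_eucl _ j); rewrite !mxE.
Qed.

End coordinate_variation.

Section band.
Context {R : realType} {d : nat}.

Definition marked_in (X : set ('rV[R]_d * R)) (s t : R) : pred 'rV[R]_d :=
  fun x => `[< exists2 r, X (x, r) & s <= r < t >].

Context {dd : measure_display} {Om : measurableType dd}.
Variables (P : probability Om R) (nu : {finite_measure set R -> \bar R}).
Variable xi : Om -> set ('rV[R]_d * R).
Hypothesis xiP : is_poisson_pp P nu xi.
Variables (s t : R).
Hypotheses (s_gt0 : 0 < s) (s_le_t : s <= t).

Definition overdense (M : R) : set Om := \bigcup_n crowded xi M^-1 s t n.+1.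

Lemma count_le_not_overdense (M : R) w l : 0 < M -> ~ overdense M w ->
  admissible_path l ->
  (count (marked_in (xi w) s t) l)%:R <= path_length l * M.
Proof.
move=> M0 not_dense [ul l0 _]; rewrite leNgt; apply/negP => lt.
set a := marked_in (xi w) s t.
have cnt0 : (0 < count a l)%N.
  rewrite lt0n; apply: contraTneq lt => ->; rewrite -leNgt mulr_ge0// ?(ltW M0)//.
  by rewrite sumr_ge0// => i _; exact: sqrtr_ge0.
apply: not_dense; exists (count a l).-1 => //; rewrite prednK//.
rewrite -size_filter; apply: crowded_points; rewrite ?invr_gt0//.
- exact: filter_uniq.
- by move=> x; rewrite mem_filter => /andP[/asboolP].
rewrite exchange_big/=.
apply: (@le_trans _ _ (\sum_(j < d) path_length l)).
  apply: ler_sum => j _.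
  apply: le_trans (variation_filter (fun x => x ord0 j) a 0 l) _.
  rewrite l0 variation_cons subrr normr0 add0r; exact: variation_le_path_length.
rewrite sumr_const card_ord size_filter -[leLHS]mulr_natl natrM -mulrA ler_wpM2l//.
by rewrite ler_pdivlMr// ltW.
Qed.

Lemma prob_overdense (M : R) : 0 < M ->
  2 * 12 ^+ d * fine (nu `[s, t[%classic) <= M ^+ d ->
  measurable (overdense M) /\
  (P (overdense M) <= (2 * 12 ^+ d * fine (nu `[s, t[%classic) / M ^+ d)%:E)%E.
Proof.
move=> M0 HM; set lam := fine _ in HM *.
have lam0 : 0 <= lam by exact: fine_ge0.
pose x := 12 ^+ d * (M^-1 ^+ d * lam).
have xE : 2 * 12 ^+ d * lam / M ^+ d = 2 * x by rewrite /x exprVn; ring.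
have x0 : 0 <= x by rewrite !mulr_ge0 ?exprn_ge0 ?invr_ge0 ?(ltW M0).
have x20 : 0 <= 2 * x by apply: mulr_ge0.
have x12 : 2 * x <= 1 by rewrite -xE ler_pdivrMr ?exprn_gt0// mul1r.
have iM0 : 0 < M^-1 by rewrite invr_gt0.
have crw n := prob_crowded xiP iM0 s_gt0 s_le_t n.
have mD : measurable (overdense M) by apply: bigcup_measurable => n _; exact: (crw _).1.
split=> //; rewrite xE.
apply: le_trans (generalized_Boole_inequality _ _ _) _ => //.
  by move=> n; exact: (crw _).1.
apply: le_trans (epsilon_trick0 xpredT x20).
apply: lee_nneseries => [n _ _|n _]; first exact: measure_ge0.
apply: le_trans (crw _).2 _; rewrite lee_fin -/lam -/x.
rewrite natrX ler_pdivlMr ?exprn_gt0// -exprMn [x * 2]mulrC exprS -[leRHS]mulr1.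
by rewrite ler_wpM2l// exprn_ile1.
Qed.

Hypothesis d_ge2 : (2 <= d)%N.

Lemma band_majorant (M : R) : 0 < M ->
  2 * 12 ^+ d * fine (nu `[s, t[%classic) <= M ^+ d ->
  exists Y : Om -> \bar R, [/\ measurable_fun setT Y, forall w, (0 <= Y w)%E,
    forall w l, admissible_path l ->
      ((count (marked_in (xi w) s t) l)%:R%:E <= (path_length l)%:E * Y w)%E &
    (\int[P]_w Y w <= (5 * M)%:E)%E].
Proof.
move=> M0 HM; set lam := fine _ in HM.
pose Mj j := M * 2 ^+ j.
have Mj0 j : 0 < Mj j by rewrite mulr_gt0 ?exprn_gt0.
have MMj j : M ^+ d <= Mj j ^+ d.
  rewrite lerXn2r ?nnegrE ?(ltW M0) ?(ltW (Mj0 j))//.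
  by rewrite ler_peMr ?(ltW M0)// exprn_ege1 ?ler1n.
have den j := prob_overdense (Mj0 j) (le_trans HM (MMj j)).
pose f j w : \bar R := ((Mj j.+1)%:E * (\1_(overdense (Mj j)) w)%:E)%E.
have f0 j w : (0 <= f j w)%E by rewrite mule_ge0 ?lee_fin ?(ltW (Mj0 _)).
have mf j : measurable_fun setT (f j).
  apply: measurable_funeM; apply/measurable_EFinP.
  by apply: measurable_indic; exact: (den j).1.
have sum0 w : (0 <= \sum_(0 <= j <oo) f j w)%E by exact: nneseries_ge0.
exists (fun w => M%:E + \sum_(0 <= j <oo) f j w)%E; split.
- apply: emeasurable_funD => //; exact: (ge0_emeasurable_sum (P := xpredT)).
- by move=> w; rewrite adde_ge0 ?lee_fin ?(ltW M0).
- move=> w l Hl; have [_ _ len0] := Hl.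
  suff [j denj Hj] : exists2 j, (forall i, (i < j)%N -> overdense (Mj i) w) &
      (count (marked_in (xi w) s t) l)%:R <= path_length l * Mj j.
    apply: (@le_trans _ _ ((path_length l)%:E * (Mj j)%:E)%E).
      by rewrite -EFinM lee_fin.
    rewrite lee_pmul2l ?lte_fin//.
    case: j denj {Hj} => [_|j /(_ j (ltnSn j)) denj].
      by rewrite /Mj expr0 mulr1 leeDl.
    apply: (@le_trans _ _ (\sum_(0 <= j <oo) f j w)%E); last by rewrite leeDr// lee_fin ltW.
    apply: le_trans (nneseries_lim_ge j.+1 _) => //.
    by rewrite big_nat_recr//= {2}/f indicE mem_set// mule1 leeDr// sume_ge0.
  have [alld|/existsNP[j0 nd0]] := pselect (forall j, overdense (Mj j) w).
    exists (Num.truncn ((count (marked_in (xi w) s t) l)%:R /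
      (path_length l * M))).+1 => //.
    rewrite /Mj mulrA -ler_pdivrMl ?mulr_gt0// mulrC.
    apply: (le_trans (ltW (truncnS_gt _))).
    by rewrite -natrX ler_nat ltnW// ltn_expl.
  have ex : exists j, ~~ `[< overdense (Mj j) w >] by exists j0; apply/negP => /asboolP.
  case: (ex_minnP ex) => j /negP nd minj; exists j.
    by move=> i ij; apply/asboolP; apply: contraTT ij => /minj; rewrite -leqNgt.
  by apply: count_le_not_overdense => // /asboolP.
- rewrite ge0_integralD//; last 2 first.
    by move=> w _; rewrite lee_fin ltW.
    exact: (ge0_emeasurable_sum (P := xpredT)).
  rewrite integral_cst//= probability_setT mule1 integral_nneseries//.
  rewrite (_ : 5 * M = M + 4 * M); last ring.
  rewrite EFinD leeD2l//.
  apply: le_trans (epsilon_trick0 xpredT (_ : 0 <= 4 * M)); last first.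
    by rewrite mulr_ge0// ltW.
  apply: lee_nneseries => [j _ _|j _]; first exact: integral_ge0.
  have [mD PD] := den j.
  rewrite ge0_integralZl_EFin//; last 2 first.
  - by apply/measurable_EFinP; exact: measurable_indic.
  - exact: ltW.
  rewrite integral_indic// setIT.
  apply: (@le_trans _ _ ((Mj j.+1)%:E * ((2 ^+ j)^-2)%:E)%E).
    rewrite lee_pmul2l ?lte_fin//; apply: le_trans PD _; rewrite lee_fin.
    rewrite ler_pdivrMr ?exprn_gt0// exprMn.
    apply: (le_trans HM); rewrite mulrCA ler_peMr ?exprn_ge0 ?(ltW M0)//.
    rewrite mulrC ler_pdivlMr ?exprn_gt0// mul1r ler_weXn2l//.
    by rewrite exprn_ege1 ?ler1n.
  rewrite -EFinM lee_fin natrX /Mj !exprS.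
  by rewrite le_eqVlt; apply/orP; left; apply/eqP; field; rewrite expf_neq0.
Qed.

End band.

(** * Summation over the bands *)

Lemma nneseries_scale_geometric_lty (R : realType) (u : nat -> R) (C : R) :
  0 <= C -> (forall n, 0 <= u n) ->
  (\sum_(0 <= n <oo) (u n)%:E < +oo)%E ->
  (\sum_(0 <= n <oo) (C * u n + (2 ^+ n.+1)^-1)%:E < +oo)%E.
Proof.
move=> C0 u0 usum.
rewrite (eq_eseriesr (g := fun n => C%:E * (u n)%:E + (1 / (2 ^ n.+1)%:R)%:E)%E);
  last by move=> n _; rewrite EFinD EFinM natrX div1r.
have v0 n : (0 <= (1 / (2 ^ n.+1)%:R : R)%:E)%E by rewrite lee_fin divr_ge0.
have w0 n : (0 <= (u n)%:E)%E by rewrite lee_fin.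
rewrite nneseriesD => [|n _ _|//]; last by rewrite mule_ge0 ?lee_fin.
rewrite nneseriesZl//.
apply: lte_add_pinfty.
  by rewrite lte_mul_pinfty// ?lee_fin.
by rewrite (le_lt_trans (epsilon_trick0 _ _)) ?ltry.
Qed.

Section bands.
Context {R : realType} {d : nat} {dd : measure_display} {Om : measurableType dd}.
Variables (P : probability Om R) (nu : {finite_measure set R -> \bar R}).
Variable xi : Om -> set ('rV[R]_d * R).
Hypothesis xiP : is_poisson_pp P nu xi.
Hypothesis d_ge2 : (2 <= d)%N.

Lemma bands_majorant (s t : nat -> R) :
  (forall n, 0 < s n) -> (forall n, s n <= t n) ->
  (\sum_(0 <= n <oo) (t n * fine (nu `[s n, t n[%classic) `^ d%:R^-1)%:E < +oo)%E ->
  exists Y : Om -> \bar R, [/\ measurable_fun setT Y, forall w, (0 <= Y w)%E,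
    forall w l, admissible_path l ->
      (\sum_(x <- l) \sum_(0 <= n <oo)
          (t n * (marked_in (xi w) (s n) (t n) x)%:R)%:E
       <= (path_length l)%:E * Y w)%E &
    (\int[P]_w Y w < +oo)%E].
Proof.
move=> s0 st sumt.
have t0 n : 0 < t n by exact: lt_le_trans (st n).
pose lam n := fine (nu `[s n, t n[%classic).
have lam0 n : 0 <= lam n by exact: fine_ge0.
pose M n := 24 * lam n `^ d%:R^-1 + (t n * 2 ^+ n.+1)^-1.
have M0 n : 0 < M n.
  by rewrite ltr_wpDl ?mulr_ge0 ?powR_ge0// invr_gt0 mulr_gt0 ?exprn_gt0.
have MP n : 2 * 12 ^+ d * lam n <= M n ^+ d.
  apply: (@le_trans _ _ ((24 * lam n `^ d%:R^-1) ^+ d)).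
    rewrite exprMn -[(_ `^ _) ^+ d]powR_mulrn ?powR_ge0// -powRrM.
    rewrite mulVf ?pnatr_eq0 -?lt0n ?(ltnW d_ge2)//.
    rewrite powRr1// ler_wpM2r//.
    rewrite (_ : 24 = 2 * 12); last ring.
    by rewrite exprMn ler_wpM2r ?exprn_ge0// ler_eXnr ?ler1n// ltnW.
  rewrite lerXn2r ?nnegrE ?mulr_ge0 ?powR_ge0 ?(ltW (M0 n))//.
  by rewrite lerDl invr_ge0 mulr_ge0 ?exprn_ge0// ltW.
have /choice[Y YP] n := band_majorant xiP (s0 n) (st n) d_ge2 (M0 n) (MP n).
pose Z n w : \bar R := ((t n)%:E * Y n w)%E.
have Z0 n w : (0 <= Z n w)%E.
  by have [_ Y0 _ _] := YP n; rewrite mule_ge0 ?lee_fin ?(ltW (t0 n)).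
have mZ n : measurable_fun setT (Z n).
  by have [mY _ _ _] := YP n; exact: measurable_funeM.
exists (fun w => \sum_(0 <= n <oo) Z n w)%E; split.
- exact: (ge0_emeasurable_sum (P := xpredT)).
- by move=> w; exact: nneseries_ge0.
- move=> w l Hl; have [_ _ len0] := Hl.
  rewrite -nneseries_sum; last first.
    by move=> x n; rewrite lee_fin mulr_ge0 ?(ltW (t0 n)).
  rewrite -nneseriesZl; last by move=> n _.
  apply: lee_nneseries => [n _ _|n _].
    by apply: sume_ge0 => x _; rewrite lee_fin mulr_ge0 ?(ltW (t0 n)).
  have [_ _ /(_ w l Hl) HY _] := YP n.
  rewrite -sum1_count big_mkcond/= in HY.
  rewrite sumEFin -mulr_sumr -natr_sum EFinM muleCA.
  by rewrite lee_pmul2l ?lte_fin.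
- rewrite integral_nneseries//.
  apply: (@le_lt_trans _ _ (\sum_(0 <= n <oo)
    (120 * (t n * lam n `^ d%:R^-1) + 5 * (2 ^+ n.+1)^-1)%:E)%E).
    apply: lee_nneseries => [n _ _|n _]; first exact: integral_ge0.
    have [mY Y0 _ HY] := YP n.
    rewrite ge0_integralZl_EFin ?(ltW (t0 n))//.
    apply: (@le_trans _ _ ((t n)%:E * (5 * M n)%:E)%E).
      by rewrite lee_pmul2l ?lte_fin.
    rewrite -EFinM lee_fin /M invfM le_eqVlt; apply/orP; left; apply/eqP.
    by field; rewrite expf_neq0//= gt_eqF.
  rewrite (eq_eseriesr (g := fun n =>
    (5%:E * (24 * (t n * lam n `^ d%:R^-1) + (2 ^+ n.+1)^-1)%:E)%E)); last first.
    by move=> n _; rewrite -EFinM; congr _%:E; ring.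
  rewrite nneseriesZl; last first.
    by move=> n _; rewrite lee_fin addr_ge0 ?mulr_ge0 ?powR_ge0
      ?(ltW (t0 n)) ?invr_ge0 ?exprn_ge0.
  rewrite lte_mul_pinfty// nneseries_scale_geometric_lty// => n.
  by rewrite mulr_ge0 ?powR_ge0 ?(ltW (t0 n)).
Qed.

End bands.

Section dyadic.
Context {R : realType}.

Lemma dyadic_ge1 (r : R) : 1 <= r -> exists n, 2 ^+ n <= r < 2 ^+ n.+1.
Proof.
move=> r1; have ex : exists n, r < 2 ^+ n.+1.
  exists (Num.truncn r); apply: (lt_le_trans (truncnS_gt _)).
  by rewrite -natrX ler_nat ltnW// ltn_expl.
case: (ex_minnP ex) => n rn minn; exists n; rewrite rn andbT.
case: n minn {rn} => [_|n minn]; first by rewrite expr0.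
by rewrite leNgt; apply/negP => /minn; rewrite ltnn.
Qed.

Lemma dyadic_lt1 (r : R) : 0 < r -> r < 1 ->
  exists n, (2 ^+ n.+1)^-1 <= r < (2 ^+ n)^-1.
Proof.
move=> r0 r1; have ex : exists n, (2 ^+ n.+1)^-1 <= r.
  have [|n /andP[_ rn]] := @dyadic_ge1 r^-1; first by rewrite invf_ge1// ltW.
  by exists n; rewrite -[leRHS]invrK lef_pV2 ?posrE ?invr_gt0 ?exprn_gt0// ltW.
case: (ex_minnP ex) => n rn minn; exists n; rewrite rn /=.
case: n minn {rn} => [_|n minn]; first by rewrite expr0 invr1.
by rewrite ltNge; apply/negP => /minn; rewrite ltnn.
Qed.

Lemma trivIset_dyadic (c : R) : 0 < c ->
  trivIset setT (fun n => `[c * 2 ^+ n, c * 2 ^+ n.+1[%classic).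
Proof.
move=> c0.
have lt m n x : (m < n)%N -> c * 2 ^+ n <= x -> x < c * 2 ^+ m.+1 -> False.
  move=> mn nx xm; have := le_lt_trans nx xm.
  by rewrite ltr_pM2l// ltr_eXn2l ?ltr1n// ltnS leqNgt mn.
apply/trivIsetP => i j _ _ ij; apply/seteqP; split=> // x [] /=.
rewrite !in_itv/= => /andP[ix xi] /andP[jx xj].
by move: ij; rewrite neq_ltn => /orP[/lt/(_ jx xi)|/lt/(_ ix xj)].
Qed.

Variables (nu : {finite_measure set R -> \bar R}) (d : nat).

Lemma le_fine_finite_measure (A B : set R) : measurable A -> measurable B ->
  A `<=` B -> fine (nu A) <= fine (nu B).
Proof.
move=> mA mB AB; rewrite fine_le ?fin_num_measure//.
by rewrite le_measure ?inE.
Qed.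

Lemma dyadic_sum_lty :
  (\int[lebesgue_measure]_(r in `[0%R, +oo[%classic)
     ((nu `[(r : R), +oo[%classic) `^ (d%:R^-1)%R) < +oo)%E ->
  (\sum_(0 <= n <oo)
     (2 ^+ n.+1 * fine (nu `[2 ^+ n, 2 ^+ n.+1[%classic) `^ d%:R^-1)%:E < +oo)%E.
Proof.
pose g (r : R) := fine (nu `[r, +oo[%classic) `^ d%:R^-1.
have -> : (fun r : R => (nu `[r, +oo[%classic `^ d%:R^-1)%E) = EFin \o g.
  by apply/funext => r /=; rewrite -poweR_EFin fineK// fin_num_measure.
have gmono r r' : r <= r' -> g r' <= g r.
  move=> rr'; rewrite ge0_ler_powR ?nnegrE ?fine_ge0// le_fine_finite_measure//.
  by apply: subset_itvr; rewrite bnd_simp.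
have mg (D : set R) : measurable D -> measurable_fun D (EFin \o g).
  move=> mD; apply/measurable_EFinP; exact: nonincreasing_measurable.
have g0 r : (0 <= (EFin \o g) r)%E by rewrite lee_fin powR_ge0.
move=> int_lty.
pose F n := `[2^-1 * 2 ^+ n, 2^-1 * 2 ^+ n.+1[%classic : set R.
apply: (@le_lt_trans _ _ (4%:E * \int[lebesgue_measure]_(r in \bigcup_n F n) (g r)%:E)%E).
  rewrite ge0_integral_bigcup => [|n||r _|]; last 4 first.
  - exact: measurable_itv.
  - by apply: mg; apply: bigcup_measurable => n _; exact: measurable_itv.
  - exact: g0.
  - by apply: trivIset_dyadic; rewrite invr_gt0.
  rewrite -nneseriesZl; last by move=> n _; apply: integral_ge0 => r _; exact: g0.
  apply: lee_nneseries => [n _ _|n _].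
    by rewrite lee_fin mulr_ge0 ?powR_ge0 ?exprn_ge0.
  apply: (@le_trans _ _ (4%:E * \int[lebesgue_measure]_(r in F n) (g (2 ^+ n))%:E)%E).
    rewrite integral_cst/=; last exact: measurable_itv.
    rewrite /F lebesgue_measure_itv/= lte_fin ltr_pM2l ?invr_gt0//.
    rewrite ltr_eXn2l ?ltr1n// ltnSn -EFinB -!EFinM lee_fin.
    rewrite (_ : 4 * (g (2 ^+ n) * _) = 2 ^+ n.+1 * g (2 ^+ n)); last first.
      by rewrite !exprS; field.
    rewrite ler_wpM2l ?exprn_ge0// ge0_ler_powR ?nnegrE ?fine_ge0//.
    by rewrite le_fine_finite_measure//; apply: subset_itvl; rewrite bnd_simp.
  rewrite lee_pmul2l ?lte_fin//; apply: ge0_le_integral.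
  - exact: measurable_itv.
  - by move=> r _; rewrite lee_fin powR_ge0.
  - exact: measurable_cst.
  - by apply: mg; exact: measurable_itv.
  - move=> r; rewrite /F/= in_itv/= exprS mulrA mulVf// mul1r => /andP[_ rn].
    by rewrite lee_fin gmono// ltW.
rewrite lte_mul_pinfty//; apply: le_lt_trans int_lty.
apply: ge0_subset_integral => //.
- by apply: bigcup_measurable => n _; exact: measurable_itv.
- exact: mg.
- by move=> r _; exact: g0.
- move=> r [n _]; rewrite /F/= !in_itv/= andbT => /andP[nr _].
  by rewrite (le_trans _ nr)// mulr_ge0 ?exprn_ge0 ?invr_ge0.
Qed.

End dyadic.

Section greedy_majorant.
Context {R : realType} {d : nat} {dd : measure_display} {Om : measurableType dd}.
Variables (P : probability Om R) (nu : {finite_measure set R -> \bar R}).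
Variable xi : Om -> set ('rV[R]_d * R).
Hypothesis xiP : is_poisson_pp P nu xi.
Hypothesis d_ge2 : (2 <= d)%N.

Lemma greedy_S_integrable_majorant :
  (\int[lebesgue_measure]_(r in `[0%R, +oo[%classic)
     ((nu `[(r : R), +oo[%classic) `^ (d%:R^-1)%R) < +oo)%E ->
  exists Y : Om -> \bar R, [/\ measurable_fun [set: Om] Y,
     (forall w, greedy_S (xi w) <= Y w)%E & (\int[P]_w Y w < +oo)%E].
Proof.
move=> /dyadic_sum_lty sumu.
have [||Yu [mYu Yu0 Yul intYu]] := bands_majorant xiP d_ge2 _ _ sumu.
- by move=> n; rewrite exprn_gt0.
- by move=> n; rewrite ler_weXn2l ?ler1n.
have [|||Yl [mYl Yl0 Yll intYl]] := @bands_majorant _ _ _ _ _ _ _ xiP d_ge2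
    (fun n => (2 ^+ n.+1)^-1) (fun n => (2 ^+ n)^-1).
- by move=> n; rewrite invr_gt0 exprn_gt0.
- by move=> n; rewrite lef_pV2 ?posrE ?exprn_gt0// ler_weXn2l ?ler1n.
- pose L := fine (nu setT) `^ d%:R^-1.
  apply: le_lt_trans (ltry (2 * L)).
  apply: le_trans (epsilon_trick0 xpredT (_ : 0 <= 2 * L)); last first.
    by rewrite mulr_ge0 ?powR_ge0.
  apply: lee_nneseries => [n _ _|n _].
    by rewrite lee_fin mulr_ge0 ?powR_ge0 ?invr_ge0 ?exprn_ge0.
  rewrite lee_fin natrX exprS invfM mulrACA divff// mul1r mulrC.
  rewrite ler_wpM2r ?invr_ge0 ?exprn_ge0// ge0_ler_powR ?nnegrE ?fine_ge0//.
  exact: le_fine_finite_measure.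
exists (fun w => Yu w + Yl w)%E; split.
- exact: emeasurable_funD.
- move=> w; apply: ge_ereal_sup => _ [l Hl <-]; have [_ _ len0] := Hl.
  rewrite lee_pdivrMr// muleC ge0_muleDr//.
  apply: le_trans (leeD (Yul w l Hl) (Yll w l Hl)).
  rewrite -big_split/=; apply: lee_sum => x _.
  set u := (\sum_(0 <= n <oo) _)%E; set v := (\sum_(0 <= n <oo) _)%E.
  have u0 : (0 <= u)%E.
    by apply: nneseries_ge0 => n _ _; rewrite lee_fin mulr_ge0 ?exprn_ge0.
  have v0 : (0 <= v)%E.
    by apply: nneseries_ge0 => n _ _; rewrite lee_fin mulr_ge0 ?invr_ge0 ?exprn_ge0.
  apply: ge_ereal_sup => _ [->|[[y r] [xir /= yx] <-]]; first exact: adde_ge0.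
  have {}xir : xi w (x, r) by rewrite -yx.
  have r0 : 0 < r by exact: xiP.1 xir.
  have [r1|r1] := leP 1 r.
    have [n nr] := dyadic_ge1 r1.
    apply: le_trans (leeDl _ v0).
    apply: le_trans (nneseries_lim_ge n.+1 _); last first.
      by move=> k _ _; rewrite lee_fin mulr_ge0 ?exprn_ge0.
    rewrite big_nat_recr//= (_ : marked_in _ _ _ x); last by apply/asboolP; exists r.
    rewrite mulr1 (@le_trans _ _ (2 ^+ n.+1)%:E)//.
      by rewrite lee_fin ltW//; case/andP: nr.
    by rewrite leeDr// sume_ge0// => k _; rewrite lee_fin mulr_ge0 ?exprn_ge0.
  have [n nr] := dyadic_lt1 r0 r1.
  apply: le_trans (leeDr _ u0).
  apply: le_trans (nneseries_lim_ge n.+1 _); last first.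
    by move=> k _ _; rewrite lee_fin mulr_ge0 ?invr_ge0 ?exprn_ge0.
  rewrite big_nat_recr//= (_ : marked_in _ _ _ x); last by apply/asboolP; exists r.
  rewrite mulr1 (@le_trans _ _ ((2 ^+ n)^-1)%:E)//.
    by rewrite lee_fin ltW//; case/andP: nr.
  by rewrite leeDr// sume_ge0// => k _; rewrite lee_fin mulr_ge0 ?invr_ge0 ?exprn_ge0.
- by rewrite ge0_integralD// lte_add_pinfty.
Qed.

End greedy_majorant.

(** * Infinite moment *)

Lemma eucl_gt0 (R : realType) (d : nat) (x : 'rV[R]_d) : x != 0 -> 0 < eucl x.
Proof.
move=> x0; have [j xj] : exists j, x ord0 j != 0.
  apply: contrapT => /forallNP H; move/eqP: x0; apply; apply/rowP => j.
  by rewrite mxE; have /negP := H j; rewrite negbK => /eqP.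
by apply: lt_le_trans (ler_coord_eucl x j); rewrite normr_gt0.
Qed.

Lemma eucl_le_box (R : realType) (d : nat) (x : 'rV[R]_d) (c : R) : 0 <= c ->
  (forall j, 0 <= x ord0 j <= c) -> eucl x <= d%:R * c.
Proof.
move=> c0 xc; rewrite -[leRHS]ger0_norm ?mulr_ge0// -sqrtr_sqr ler_wsqrtr//.
apply: (@le_trans _ _ (\sum_(j < d) c ^+ 2)).
  apply: ler_sum => j _; have /andP[x0 xjc] := xc j.
  by rewrite lerXn2r ?nnegrE.
rewrite sumr_const card_ord exprMn -[leLHS]mulr_natl ler_wpM2r ?sqr_ge0//.
by rewrite -natrX ler_nat; case: (d) => // m; rewrite leq_pmulr.
Qed.

Lemma sum_unbounded (R : realType) (u : nat -> R) : (forall n, 0 <= u n) ->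
  (\sum_(0 <= n <oo) (u n)%:E = +oo)%E ->
  forall B, exists n, B < \sum_(k < n) u k.
Proof.
move=> u0 usum B; apply: contrapT => /forallNP nex.
suff : (+oo <= B%:E :> \bar R)%E by rewrite leye_eq.
rewrite -usum; apply: lime_le.
  by apply: is_cvg_nneseries => n _ _; rewrite lee_fin.
near=> n; rewrite sumEFin lee_fin big_mkord leNgt; apply/negP; exact: nex.
Unshelve. all: by end_near. Qed.

Section infinite_moment.
Context {R : realType} {d : nat} {dd : measure_display} {Om : measurableType dd}.
Variables (P : probability Om R) (nu : {finite_measure set R -> \bar R}).
Variable xi : Om -> set ('rV[R]_d * R).
Hypothesis xiP : is_poisson_pp P nu xi.
Hypothesis d_gt0 : (0 < d)%N.

Lemma greedy_S_ge_single w x r : xi w (x, r) -> x != 0 ->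
  ((r / eucl x)%:E <= greedy_S (xi w))%E.
Proof.
move=> xr x0.
have e0 := eucl_gt0 x0.
pose l : seq 'rV[R]_d := [:: 0; x].
have len : path_length l = eucl x by rewrite /path_length big_ord1 /= subr0.
apply: (@le_trans _ _ (path_weight (xi w) l * ((path_length l)^-1)%:E)%E).
  rewrite len EFinM lee_pmul2r ?lte_fin ?invr_gt0//.
  rewrite /path_weight big_cons big_seq1.
  apply: (@le_trans _ _ (rmark (xi w) x)).
    by apply: ereal_sup_ubound; right; exists (x, r).
  by rewrite leeDr//; apply: ereal_sup_ubound; left.
apply: ereal_sup_ubound; exists l => //.
by split=> //=; rewrite ?len// inE andbT eq_sym.
Qed.

Hypothesis moment :
  (\int[nu]_(r in `]0%R, +oo[%classic) ((r ^+ d)%:E) = +oo)%E.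

Lemma dyadic_moment_series :
  (\sum_(0 <= k <oo) ((2 ^+ k) ^+ d * fine (nu `[2 ^+ k, 2 ^+ k.+1[%classic))%:E
     = +oo)%E.
Proof.
pose F k := `[1 * 2 ^+ k, 1 * 2 ^+ k.+1[%classic : set R.
have mpow (D : set R) : measurable D -> measurable_fun D (fun r : R => (r ^+ d)%:E).
  by move=> mD; apply/measurable_EFinP; exact: measurable_funX.
have mF k : measurable (F k) by exact: measurable_itv.
have mbF : measurable (\bigcup_k F k) by exact: bigcup_measurable.
have F1 r : (\bigcup_k F k) r <-> 1 <= r.
  split=> [[k _]|/dyadic_ge1[k kr]]; last by exists k; rewrite // /F/= in_itv/= !mul1r.
  rewrite /F/= in_itv/= !mul1r => /andP[+ _]; apply: le_trans.
  by rewrite exprn_ege1// ler1n.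
have intF : (\int[nu]_(r in \bigcup_k F k) (r ^+ d)%:E = +oo)%E.
  move: moment.
  rewrite (_ : `]0, +oo[%classic = `]0, 1[%classic `|` \bigcup_k F k); last first.
    apply/seteqP; split=> r /=; rewrite !in_itv/= andbT.
      by move=> r0; have [r1|r1] := ltP r 1; [left; rewrite r0 | right; apply/F1].
    by case=> [/andP[]//|/F1]; exact: lt_le_trans.
  rewrite ge0_integral_setU//; last 3 first.
  - by apply: mpow; apply: measurableU.
  - move=> r H; rewrite lee_fin exprn_ge0//; move: H => [/=|/F1].
      by rewrite in_itv/= => /andP[/ltW].
    exact: le_trans.
  - rewrite disj_set2E; apply/eqP/seteqP; split=> // r [/=].
    by rewrite in_itv/= => /andP[_ r1] /F1; rewrite leNgt r1.
  set I1 := (X in (X + _)%E).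
  have I1fin : (I1 < +oo)%E.
    apply: (@le_lt_trans _ _ (\int[nu]_(r in `]0%R, 1%R[%classic) 1)%E).
      apply: ge0_le_integral => //.
      + by move=> r /=; rewrite in_itv/= => /andP[/ltW r0 _]; rewrite lee_fin exprn_ge0.
      + exact: mpow.
      + move=> r /=; rewrite in_itv/= => /andP[/ltW r0 /ltW r1].
        by rewrite lee_fin exprn_ile1.
    by rewrite integral_cst// mul1e ltey_eq fin_num_measure.
  by move: I1 I1fin => [a| |]//= _; case: (\int[nu]_(r in _) _)%E.
apply/eqP; rewrite -leye_eq.
apply: (@le_trans _ _ (((2 ^+ d)^-1)%:E * \int[nu]_(r in \bigcup_k F k) (r ^+ d)%:E)%E).
  by rewrite intF gt0_muley// lte_fin invr_gt0 exprn_gt0.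
rewrite ge0_integral_bigcup; last 4 first.
- exact: mF.
- exact: mpow.
- by move=> r /F1 r1; rewrite lee_fin exprn_ge0// (le_trans _ r1).
- exact: trivIset_dyadic.
have ge0F k r : F k r -> (0 <= (r ^+ d)%:E)%E.
  move=> Fr; rewrite lee_fin exprn_ge0//; apply: (@le_trans _ _ 1) => //.
  by apply/F1; exists k.
rewrite -nneseriesZl; last by move=> k _; apply: integral_ge0 => r; exact: ge0F.
apply: lee_nneseries => [k _ _|k _].
  by rewrite mule_ge0 ?lee_fin ?invr_ge0 ?exprn_ge0//; apply: integral_ge0 => r;
    exact: ge0F.
apply: (@le_trans _ _ (((2 ^+ d)^-1)%:E *
    \int[nu]_(r in F k) (cst ((2 ^+ k.+1) ^+ d)%:E r))%E).
  rewrite lee_pmul2l ?lte_fin ?invr_gt0 ?exprn_gt0//.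
  apply: ge0_le_integral => //; first exact: ge0F.
  - exact: mpow.
  - move=> r Fr; move: (Fr); rewrite /F/= in_itv/= !mul1r => /andP[kr rk].
    by rewrite lee_fin lerXn2r ?nnegrE ?exprn_ge0 ?(ltW rk)// (le_trans _ kr)// exprn_ge0.
rewrite integral_cst// /F !mul1r.
rewrite -[X in (_ * (_ * X) <= _)%E]fineK ?fin_num_measure// -!EFinM lee_fin.
by rewrite mulrA exprS exprMn mulKf// expf_neq0.
Qed.

Lemma ae_greedy_S_ge (M : nat) :
  {ae P, forall w, (M.+1%:R%:E <= greedy_S (xi w))%E}.
Proof.
pose c k : R := 2 ^+ k / (d%:R * M.+1%:R).
have dM0 : 0 < d%:R * M.+1%:R :> R by rewrite mulr_gt0 ?ltr0n.
have c0 k : 0 < c k by rewrite divr_gt0 ?exprn_gt0.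
pose C k := @cell R d (fun=> c k / 2) (fun=> c k) (2 ^+ k) (2 ^+ k.+1).
pose mean k := (c k / 2) ^+ d * fine (nu `[2 ^+ k, 2 ^+ k.+1[%classic).
have mean0 k : 0 <= mean k.
  by rewrite mulr_ge0 ?exprn_ge0 ?fine_ge0 ?divr_ge0 ?(ltW (c0 k)).
pose E n := [set w | forall k : 'I_n, xi w `&` C k = set0].
have EP n : measurable (E n) /\ P (E n) = (expR (- \sum_(k < n) mean k))%:E.
  have [] := @prob_counts_eq0 R d dd Om P nu xi xiP n (fun k _ => c k / 2)
    (fun k _ => c k) (fun k => 2 ^+ k) (fun k => 2 ^+ k.+1).
  - by move=> k; rewrite exprn_gt0.
  - by move=> k; rewrite ler_weXn2l ?ler1n.
  - by move=> k _; rewrite ler_pdivrMr// ler_peMr ?ler1n ?(ltW (c0 k)).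
  - move=> k k' kk'; apply/seteqP; split=> // p [[_ kp] [_ kp']].
    have /trivIsetP/(_ (val k) (val k') Logic.I Logic.I kk') := @trivIset_dyadic R 1 ltr01.
    by move=> /seteqP[/(_ p.2)]; rewrite /= !in_itv/= !mul1r => /(_ (conj kp kp')).
  move=> mE ->; split=> //; congr (expR (- _))%:E; apply: eq_bigr => k _.
  rewrite /mean (eq_bigr (fun=> c k / 2)) ?prodr_const ?card_ord// => j _.
  by rewrite {1}[c k]splitr addrK.
have mean_sum : (\sum_(0 <= k <oo) (mean k)%:E = +oo)%E.
  pose q : R := (2 * (d%:R * M.+1%:R))^-1 ^+ d.
  have q0 : 0 < q by rewrite exprn_gt0// invr_gt0 mulr_gt0.
  rewrite (eq_eseriesr (g := fun k => (q%:E * ((2 ^+ k) ^+ d *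
      fine (nu `[2 ^+ k, 2 ^+ k.+1[%classic))%:E)%E)); last first.
    move=> k _; rewrite -EFinM mulrA; congr (_ * _)%:E.
    by rewrite /q -exprMn; congr (_ ^+ _); rewrite /c !invfM; ring.
  rewrite nneseriesZl; last by move=> k _; rewrite lee_fin mulr_ge0 ?exprn_ge0 ?fine_ge0.
  by rewrite dyadic_moment_series gt0_muley.
have mN : measurable (\bigcap_n E n) by apply: bigcapT_measurable => n; exact: (EP n).1.
exists (\bigcap_n E n); split=> //.
  have pfin : P (\bigcap_n E n) \is a fin_num by exact: fin_num_measure.
  apply/eqP; rewrite eq_le measure_ge0 andbT leNgt; apply/negP => p0.
  set p := P _ in pfin p0.
  have fp0 : 0 < fine p by rewrite fine_gt0// p0 ltey_eq pfin.
  have [n Hn] := sum_unbounded mean0 mean_sum (fine p)^-1.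
  have : (p <= P (E n))%E.
    by apply: le_measure; rewrite ?inE//; [exact: (EP n).1 | exact: bigcap_inf].
  rewrite (EP n).2 -(fineK pfin) lee_fin; apply/negP; rewrite -ltNge expRN.
  rewrite -[ltRHS]invrK ltf_pV2 ?posrE ?expR_gt0 ?invr_gt0//.
  by apply: (lt_trans Hn); apply: lt_le_trans (expR_ge1Dx _); rewrite ltrDr.
move=> w /= nS n _ k; apply/seteqP; split=> // -[x r].
move=> [xr [/= xC /andP[kr _]]]; apply: nS.
have x0 : x != 0.
  apply/eqP => x0; have := xC (Ordinal d_gt0); rewrite x0 mxE => /andP[+ _].
  by apply/negP; rewrite -ltNge divr_gt0.
apply: le_trans (greedy_S_ge_single xr x0); rewrite lee_fin.
rewrite ler_pdivlMr ?eucl_gt0//; apply: le_trans kr.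
apply: (@le_trans _ _ (M.+1%:R * (d%:R * c k))).
  rewrite ler_wpM2l// eucl_le_box ?(ltW (c0 k))// => j.
  have /andP[cx xc] := xC j; rewrite (ltW xc) andbT.
  by rewrite (le_trans _ cx)// divr_ge0 ?(ltW (c0 k)).
by rewrite mulrA [M.+1%:R * _]mulrC /c mulrCA divff ?mulr1// gt_eqF.
Qed.

Lemma ae_greedy_S_infinite : {ae P, forall w, greedy_S (xi w) = +oo%E}.
Proof.
have := ae_foralln ae_greedy_S_ge; apply: filterS => w H.
apply/eqyP => A A0; apply: le_trans (H (Num.truncn A)).
by rewrite lee_fin ltW// truncnS_gt.
Qed.

End infinite_moment.

Local Open Scope ereal_scope.

Theorem theorem1p2 (R : realType) (d : nat) (nu : {finite_measure set R -> \bar R})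
  (dd : measure_display) (Om : measurableType dd) (P : probability Om R)
  (xi : Om -> set ('rV[R]_d * R)) :
  (2 <= d)%N ->
  nu `]-oo, 0%R]%classic = 0 ->
  is_poisson_pp P nu xi ->
  (\int[lebesgue_measure]_(r in `[0%R, +oo[%classic) ((nu `[(r : R), +oo[%classic) `^ (d%:R^-1)%R)
      < +oo ->
   exists Y : Om -> \bar R, [/\ measurable_fun [set: Om] Y,
     (forall w, greedy_S (xi w) <= Y w) & \int[P]_w Y w < +oo])
  /\
  (\int[nu]_(r in `]0%R, +oo[%classic) ((r ^+ d)%:E) = +oo ->
   {ae P, forall w, greedy_S (xi w) = +oo}).
Proof.
move=> d_ge2 _ xiP; split; first exact: greedy_S_integrable_majorant.
by move=> moment; apply: (ae_greedy_S_infinite xiP) => //; exact: ltnW.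
Qed.
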